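(* Let $n\ge 1$ and let $\mathcal{G}$ be an abelian sub-semigroup of $MA(n,\mathbb{C})$. If $\mathcal{G}$ is generated by $n$ commuting invertible affine maps, then it has no dense orbit.
   Context: $MA(n,\mathbb{C})$ is the set of affine maps $f:\mathbb{C}^n\to\mathbb{C}^n$, $f(x)=Ax+a$, with $A\in M_n(\mathbb{C})$, $a\in\mathbb{C}^n$, a semigroup under composition. The orbit of $v\in\mathbb{C}^n$ is $\mathcal{G}(v)=\{f(v):f\in\mathcal{G}\}$; ''dense'' means dense in $\mathbb{C}^n$. *)

(* Defs.v *)
From HB Require Import structures.
From mathcomp Require Export all_boot all_order all_algebra.
From mathcomp Require Export all_classical all_reals all_analysis.
From mathcomp Require Export complex.
Export numFieldNormedType.Exports.

Set Implicit Arguments.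
Unset Strict Implicit.
Unset Printing Implicit Defensive.

Import Order.TTheory GRing.Theory Num.Theory.

Local Open Scope classical_set_scope.
Local Open Scope ring_scope.

(* The library has no topology on R[i] itself; this is the one given by the
   modulus. 'cV[R[i]]_n then carries the product topology of C^n. *)
HB.instance Definition _ (R : realType) :=
  PseudoPointedMetric.copy R[i] R[i]^o.
HB.instance Definition _ (R : realType) := NormedModule.copy R[i] R[i]^o.

Section affine_maps.
Variables (R : realType) (n : nat).
Implicit Types G S : set ('cV[R[i]]_n -> 'cV[R[i]]_n).

Definition MA : set ('cV[R[i]]_n -> 'cV[R[i]]_n) :=
  [set f | exists (A : 'M[R[i]]_n) (a : 'cV[R[i]]_n),
     forall x : 'cV[R[i]]_n, f x = A *m x + a].

(* A sub-semigroup is not required to contain the identity. *)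
Definition subsemigroup_MA G : Prop :=
  G `<=` MA /\ (forall f g, G f -> G g -> G (f \o g)).

Definition abelian_maps G : Prop :=
  forall f g, G f -> G g -> f \o g = g \o f.

Definition semigroup_generated S : set ('cV[R[i]]_n -> 'cV[R[i]]_n) :=
  smallest subsemigroup_MA S.

Definition orbit_of G (v : 'cV[R[i]]_n) : set 'cV[R[i]]_n :=
  [set f v | f in G].

End affine_maps.

(* Main.v *)
Require Import Defs.
From mathcomp Require Import zify ring lra.

(** Suppose that the orbit of v is dense. Identify x in C^n with the vector
    lift x = (1, x) of C^(n+1), so that the maps f_k become commuting invertible
    matrices F_k of size n+1, and put w = lift v. The functionals that vanish on
    the lifted orbit are zero, so w is a cyclic vector for the commutative algebra
    A of matrices generated by the F_k, taken here as their double commutant;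
    hence X |-> X w is a linear bijection from A onto C^(n+1)
    ([cyclic_double_commutant]).

    The group of units of A carries at least n+1 continuous homomorphisms to the
    reals, and no nonzero real combination of them is integer valued
    ([exists_log_family]). They come from logarithms. A is a product of local
    algebras, cut out by idempotents e. On such a factor every X is chi(X) times
    a unipotent; the homomorphisms are ln |chi(X)| and the real parts of enough
    independent linear functionals of the logarithm of the unipotent part. Taking
    ln |chi| only, instead of a branch of log chi, costs one real dimension out of
    2 dim (eA), and dim (eA) real homomorphisms remain in any case; this is why n
    generators are too few. On scalars all these homomorphisms are multiples
    of ln |c|.

    Let phi be a real combination of these homomorphisms, with at least n+1
    coefficients. That phi vanish on scalars and take the same value, 0 or 1, on
    F_1, ..., F_n amounts to n+1 linear conditions on the coefficients. There is a
    nonzero solution with value 0 if the homogeneous system has one; otherwise the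
    system is square and invertible, and there is a solution with value 1
    ([integral_combination]). Then phi is an integer at every lift of an element
    of the semigroup and at its scalar multiples. As these are dense among the
    units of A and phi is continuous, phi is an integer at every unit, so
    phi = 0: a contradiction. *)

Set Implicit Arguments.
Unset Strict Implicit.
Unset Printing Implicit Defensive.

Import Order.TTheory GRing.Theory Num.Theory.
Import Normc.

Local Open Scope classical_set_scope.
Local Open Scope ring_scope.

(** * Continuity of complex-valued and matrix-valued functions *)

Lemma continuous_normc_contracting (R : realType) (f : R[i] -> R) :
  (forall x y, `|f x - f y| <= normc (x - y)) -> continuous f.
Proof.
move=> hf z A /nbhs_ballP[e e0 HA]; apply/nbhs_ballP.
exists (e%:C)%C; first by rewrite /= ltcR.
move=> y; rewrite -ball_normE /= => zy.
have {}zy : normc (z - y) < e by rewrite -ltcR.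
by apply: HA; rewrite -ball_normE /=; apply: le_lt_trans zy.
Qed.

Lemma continuous_Re (R : realType) : continuous (@complex.Re R : R[i] -> R).
Proof.
apply: continuous_normc_contracting => -[a b] [c d] /=.
by rewrite -sqrtr_sqr ler_wsqrtr// lerDl sqr_ge0.
Qed.

Lemma continuous_Im (R : realType) : continuous (@complex.Im R : R[i] -> R).
Proof.
apply: continuous_normc_contracting => -[a b] [c d] /=.
by rewrite -sqrtr_sqr ler_wsqrtr// lerDr sqr_ge0.
Qed.

Lemma ReD (R : rcfType) (x y : R[i]) : complex.Re (x + y) = complex.Re x + complex.Re y.
Proof. by case: x y => [a b] [c d]. Qed.

Lemma ReZ (R : rcfType) (a : R) (x : R[i]) :
  complex.Re ((a%:C)%C * x) = a * complex.Re x.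
Proof. by case: x => b c /=; rewrite mul0r subr0. Qed.

Lemma Re_sum (R : rcfType) (I : Type) (s : seq I) (F : I -> R[i]) :
  complex.Re (\sum_(i <- s) F i) = \sum_(i <- s) complex.Re (F i).
Proof. by elim: s => [|i s IH]; rewrite ?big_nil// !big_cons ReD IH. Qed.

Lemma ln_normcM (R : realType) (a b : R[i]) : a != 0 -> b != 0 ->
  ln (normc (a * b)) = ln (normc a) + ln (normc b).
Proof.
have pos (z : R[i]) : z != 0 -> 0 < normc z.
  by move=> z0; rewrite -ltcR; change (0 < `|z|); rewrite normr_gt0.
by move=> a0 b0; rewrite normcM lnM// posrE pos.
Qed.

Section ccontinuous.
Variables (R : realType) (S : topologicalType) (s0 : S).
Implicit Types f g : S -> R[i].

(** Continuity at [s0] for the topology given by the modulus, read on the real and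
    imaginary parts: the algebraic operations then reduce to those of the reals. *)
Definition ccontinuous f :=
  {for s0, continuous (fun s => complex.Re (f s))} /\
  {for s0, continuous (fun s => complex.Im (f s))}.

Lemma ccontinuous_cst c : ccontinuous (fun=> c).
Proof. by split; apply: cst_continuous. Qed.

Lemma ccontinuousD f g : ccontinuous f -> ccontinuous g ->
  ccontinuous (fun s => f s + g s).
Proof.
move=> [f1 f2] [g1 g2]; split.
- rewrite (_ : (fun s => _) = fun s => complex.Re (f s) + complex.Re (g s)).
    exact: (continuousD f1 g1).
  by apply/funext => s; case: (f s) (g s) => [a b] [c d].
- rewrite (_ : (fun s => _) = fun s => complex.Im (f s) + complex.Im (g s)).
    exact: (continuousD f2 g2).
  by apply/funext => s; case: (f s) (g s) => [a b] [c d].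
Qed.

Lemma ccontinuousM f g : ccontinuous f -> ccontinuous g ->
  ccontinuous (fun s => f s * g s).
Proof.
move=> [f1 f2] [g1 g2]; split.
- rewrite (_ : (fun s => _) = fun s => complex.Re (f s) * complex.Re (g s) -
     complex.Im (f s) * complex.Im (g s)).
    exact: (continuousB (continuousM f1 g1) (continuousM f2 g2)).
  by apply/funext => s; case: (f s) (g s) => [a b] [c d].
- rewrite (_ : (fun s => _) = fun s => complex.Re (f s) * complex.Im (g s) +
     complex.Im (f s) * complex.Re (g s)).
    exact: (continuousD (continuousM f1 g2) (continuousM f2 g1)).
  by apply/funext => s; case: (f s) (g s) => [a b] [c d].
Qed.

Lemma ccontinuous_sum (I : Type) (r : seq I) (F : I -> S -> R[i]) :
  (forall i, ccontinuous (F i)) -> ccontinuous (fun s => \sum_(i <- r) F i s).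
Proof.
move=> hF; elim: r => [|i r IH].
  rewrite (_ : (fun s => _) = fun=> 0); last by apply/funext => s; rewrite big_nil.
  exact: ccontinuous_cst.
rewrite (_ : (fun s => _) = fun s => F i s + \sum_(j <- r) F j s).
  exact: ccontinuousD.
by apply/funext => s; rewrite big_cons.
Qed.

Lemma continuous_ln_normc f : ccontinuous f -> f s0 != 0 ->
  {for s0, continuous (fun s => ln (normc (f s)))}.
Proof.
move=> [f1 f2] fs0.
apply: (@continuous_comp _ _ _ (fun s => normc (f s)) (@ln R)).
  rewrite (_ : (fun s => _) = fun s =>
      Num.sqrt (complex.Re (f s) * complex.Re (f s) +
                complex.Im (f s) * complex.Im (f s))); last first.
    by apply/funext => s; case: (f s) => a b /=; rewrite !expr2.
  apply: (@continuous_comp _ _ _ (fun s => complex.Re (f s) * complex.Re (f s) +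
                complex.Im (f s) * complex.Im (f s)) Num.sqrt).
    exact: (continuousD (continuousM f1 f1) (continuousM f2 f2)).
  exact: sqrt_continuous.
by apply: continuous_ln; rewrite -ltcR; change (0 < `|f s0|); rewrite normr_gt0.
Qed.

Lemma ccontinuousV f : ccontinuous f -> f s0 != 0 ->
  ccontinuous (fun s => (f s)^-1).
Proof.
move=> [f1 f2] fs0.
have cq : {for s0, continuous (fun s => (complex.Re (f s) * complex.Re (f s) +
    complex.Im (f s) * complex.Im (f s))^-1)}.
  apply: continuousV.
    move: fs0; case: (f s0) => a b; apply: contraNneq => /= /eqP.
    by rewrite -!expr2 paddr_eq0 ?sqr_ge0// !sqrf_eq0 => /andP[/eqP-> /eqP->].
  exact: (continuousD (continuousM f1 f1) (continuousM f2 f2)).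
split.
- rewrite (_ : (fun s => _) = fun s => complex.Re (f s) *
    (complex.Re (f s) * complex.Re (f s) + complex.Im (f s) * complex.Im (f s))^-1).
    exact: (continuousM f1 cq).
  by apply/funext => s; case: (f s) => a b /=; rewrite !expr2.
- rewrite (_ : (fun s => _) = fun s => - (complex.Im (f s) *
    (complex.Re (f s) * complex.Re (f s) + complex.Im (f s) * complex.Im (f s))^-1)).
    exact: (continuousN (continuousM f2 cq)).
  by apply/funext => s; case: (f s) => a b /=; rewrite !expr2.
Qed.
End ccontinuous.

Lemma ccontinuous_coord (R : realType) n (i : 'I_n) (x : 'cV[R[i]]_n) :
  ccontinuous x (fun y : 'cV[R[i]]_n => y i 0).
Proof.
split.
- apply: (@continuous_comp _ _ _ (fun y : 'cV[R[i]]_n => y i 0)).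
  exact: coord_continuous.
  exact: continuous_Re.
- apply: (@continuous_comp _ _ _ (fun y : 'cV[R[i]]_n => y i 0)).
  exact: coord_continuous.
  exact: continuous_Im.
Qed.

Section mxcontinuous.
Variables (R : realType) (S : topologicalType) (s0 : S).

Definition mxcontinuous m n (P : S -> 'M[R[i]]_(m, n)) :=
  forall a b, ccontinuous s0 (fun s => P s a b).

Lemma mxcontinuous_cst m n (A : 'M[R[i]]_(m, n)) : mxcontinuous (fun=> A).
Proof. by move=> a b; exact: ccontinuous_cst. Qed.

Lemma mxcontinuousD m n (P Q : S -> 'M[R[i]]_(m, n)) :
  mxcontinuous P -> mxcontinuous Q -> mxcontinuous (fun s => P s + Q s).
Proof.
move=> hP hQ a b; rewrite (_ : (fun s => _) = fun s => P s a b + Q s a b).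
  exact: ccontinuousD.
by apply/funext => s; rewrite mxE.
Qed.

Lemma mxcontinuousZ m n (c : S -> R[i]) (P : S -> 'M[R[i]]_(m, n)) :
  ccontinuous s0 c -> mxcontinuous P -> mxcontinuous (fun s => c s *: P s).
Proof.
move=> hc hP a b; rewrite (_ : (fun s => _) = fun s => c s * P s a b).
  exact: ccontinuousM.
by apply/funext => s; rewrite mxE.
Qed.

Lemma mxcontinuousM m n p (P : S -> 'M[R[i]]_(m, n)) (Q : S -> 'M[R[i]]_(n, p)) :
  mxcontinuous P -> mxcontinuous Q -> mxcontinuous (fun s => P s *m Q s).
Proof.
move=> hP hQ a b; rewrite (_ : (fun s => _) = fun s => \sum_j P s a j * Q s j b).
  by apply: ccontinuous_sum => j; exact: ccontinuousM.
by apply/funext => s; rewrite mxE.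
Qed.

Lemma mxcontinuousX n k (P : S -> 'M[R[i]]_n.+1) :
  mxcontinuous P -> mxcontinuous (fun s => P s ^+ k).
Proof.
move=> hP; elim: k => [|k IH]; first exact: mxcontinuous_cst.
rewrite (_ : (fun s => _) = fun s => P s *m P s ^+ k); first exact: mxcontinuousM.
by apply/funext => s; rewrite exprS.
Qed.

Lemma mxcontinuous_sum m n (I : Type) (r : seq I) (F : I -> S -> 'M[R[i]]_(m, n)) :
  (forall i, mxcontinuous (F i)) -> mxcontinuous (fun s => \sum_(i <- r) F i s).
Proof.
move=> hF a b; rewrite (_ : (fun s => _) = fun s => \sum_(i <- r) F i s a b).
  by apply: ccontinuous_sum => j; exact: hF.
by apply/funext => s; rewrite summxE.
Qed.
End mxcontinuous.

(** * Nilpotent matrices and the logarithm of a unipotent matrix *)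

Section nilpotent.
Variables (K : fieldType) (N : nat).
Implicit Types x y : 'M[K]_N.+1.

Definition nilpotent_mx x := x ^+ N.+1 = 0.

(** The minimal polynomial of a nilpotent matrix divides a power of 'X, and by
    Cayley-Hamilton its degree is at most the size of the matrix; so one exponent
    serves for all nilpotent matrices. *)
Lemma nilpotent_mxP x k : x ^+ k = 0 -> nilpotent_mx x.
Proof.
move=> xk0.
have : mxminpoly x %| ('X - 0%:P) ^+ k.
  by apply/mxminpoly_minP; rewrite subr0 rmorphXn/= horner_mx_X.
case/dvdp_exp_XsubCP => i [_ pi].
have : (size (mxminpoly x) <= N.+2)%N.
  rewrite -(size_char_poly x) dvdp_leq ?mxminpoly_dvd_char//.
  by rewrite monic_neq0// char_poly_monic.
rewrite (eqp_size pi) size_exp_XsubC ltnS => iN.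
have xi : x ^+ i = 0.
  rewrite -[x ^+ i](_ : horner_mx x (('X - 0%:P) ^+ i) = _); last first.
    by rewrite subr0 rmorphXn/= horner_mx_X.
  by apply/mxminpoly_minP; rewrite (eqp_dvdl _ pi).
by rewrite /nilpotent_mx -[X in x ^+ X](subnK iN) exprD xi mulr0.
Qed.

Lemma nilpotent_mxM x y : GRing.comm x y -> nilpotent_mx x -> nilpotent_mx (x * y).
Proof. by move=> xy x0; rewrite /nilpotent_mx exprMn_comm// x0 mul0r. Qed.

Lemma nilpotent_mxZ c x : nilpotent_mx x -> nilpotent_mx (c *: x).
Proof. by move=> x0; rewrite /nilpotent_mx exprZn x0 scaler0. Qed.

Lemma nilpotent_mxD x y : GRing.comm x y ->
  nilpotent_mx x -> nilpotent_mx y -> nilpotent_mx (x + y).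
Proof.
move=> xy x0 y0; apply: (@nilpotent_mxP _ (N.+1 + N.+1)).
rewrite exprDn_comm// big1// => i _.
have [iN|Ni] := leqP N.+1 i.
  by rewrite -(subnK iN) [y ^+ _]exprD y0 !mulr0 mul0rn.
rewrite -addnBA; last exact: ltnW.
by rewrite exprD x0 !mul0r mul0rn.
Qed.

Lemma nilpotent_mx_unit x : nilpotent_mx x -> 1 + x \is a GRing.unit.
Proof.
move=> x0; apply/unitrP; exists (\sum_(i < N.+1) (- x) ^+ i).
have E : (- x) ^+ N.+1 = 0 by rewrite exprNn x0 mulr0.
have := subrX1 (- x) N.+1; rewrite E sub0r -opprD mulNr => /oppr_inj.
rewrite addrC => H; split; rewrite [RHS]H//.
rewrite mulr_suml mulr_sumr; apply: eq_bigr => i _.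
apply: commr_sym; apply: commrX; apply: commrN; apply: commr_sym.
by apply: commrD; [exact: commr1|].
Qed.
End nilpotent.

Lemma big_ord_trailing0 (V : nmodType) (F : nat -> V) p q : (p <= q)%N ->
  (forall i, (p <= i)%N -> F i = 0) -> \sum_(i < q) F i = \sum_(i < p) F i.
Proof.
move=> pq F0; rewrite -!(big_mkord predT) (big_cat_nat (leq0n p) pq)//=.
by rewrite [X in _ + X]big_nat_cond [X in _ + X]big1 ?addr0// => i /andP[/andP[/F0]].
Qed.

Section unipotent_log.
Variables (K : numFieldType) (N : nat).
Implicit Types x y : 'M[K]_N.+1.

(** The binomial coefficient 'C(X, k), as a polynomial in X. *)
Definition binpoly k : {poly K} :=
  k`!%:R^-1 *: \prod_(i < k) ('X - i%:R%:P).

Lemma horner_binpoly k m : (binpoly k).[m%:R] = 'C(m, k)%:R.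
Proof.
rewrite hornerZ horner_prod.
have -> : \prod_(i < k) ('X - i%:R%:P).[m%:R] = (m ^_ k)%:R :> K.
  rewrite ffact_prod natr_prod.
  have [km|mk] := leqP k m.
    apply: eq_bigr => i _; rewrite hornerXsubC natrB//.
    by apply: leq_trans km; apply: ltnW.
  rewrite (bigD1 (Ordinal mk))//= hornerXsubC subrr mul0r.
  by rewrite (bigD1 (Ordinal mk))//= subnn mul0r.
rewrite -bin_ffact natrM mulrC mulfK// pnatr_eq0 -lt0n; exact: fact_gt0.
Qed.

Lemma binpoly1 : binpoly 1 = 'X.
Proof. by rewrite /binpoly big_ord1 invr1 scale1r subr0. Qed.

(** The matrix of polynomials in m whose value at every natural number m is
    (1 + x) ^+ m, for a nilpotent x. *)
Definition powpoly x : 'M[{poly K}]_N.+1 :=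
  \matrix_(a, b) \sum_(k < N.+1) (x ^+ k) a b *: binpoly k.

Lemma horner_powpoly x m a b : nilpotent_mx x ->
  (powpoly x a b).[m%:R] = ((1 + x) ^+ m) a b.
Proof.
move=> x0; rewrite mxE horner_sum.
under eq_bigr do rewrite hornerZ horner_binpoly.
rewrite addrC exprD1n summxE.
pose F k := (x ^+ k) a b * 'C(m, k)%:R.
under [RHS]eq_bigr => i _ do
  rewrite -scaler_nat mxE mulrC (_ : _ * _ = F i)//.
rewrite -[LHS](big_ord_trailing0 (F := F) (leq_addr m.+1 _)); last first.
  by move=> k /subnK<-; rewrite /F exprD x0 mulr0 mxE mul0r.
rewrite -[RHS](big_ord_trailing0 (F := F) (leq_addl N.+1 _))// => k mk.
by rewrite /F bin_small// mulr0.
Qed.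

Lemma poly_nat_inj (p q : {poly K}) :
  (forall m : nat, p.[m%:R] = q.[m%:R]) -> p = q.
Proof.
move=> pq; apply/eqP; rewrite -subr_eq0; apply/negPn/negP => d0.
pose s := [seq (m%:R : K) | m <- iota 0 (size (p - q))].
have := @max_poly_roots _ _ s d0.
rewrite size_map size_iota ltnn => /(_ _ _) H; apply: notF; apply: H.
  by apply/allP => _ /mapP[m _ ->]; rewrite rootE hornerD hornerN pq subrr.
by rewrite map_inj_uniq ?iota_uniq// => i j /eqP; rewrite eqr_nat => /eqP.
Qed.

(** The logarithm of 1 + x is the derivative at 0 of m |-> (1 + x) ^+ m, so it is
    the coefficient of degree 1 of [powpoly x]. *)
Definition mxlog1p x : 'M[K]_N.+1 := \sum_(k < N.+1) (binpoly k)`_1 *: x ^+ k.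

Lemma mxlog1pE x a b : mxlog1p x a b = (powpoly x a b)`_1.
Proof.
rewrite summxE mxE coef_sum; apply: eq_bigr => k _.
by rewrite mxE [RHS]coefZ mulrC.
Qed.

Lemma powpoly0 x a b : nilpotent_mx x -> (powpoly x a b)`_0 = (a == b)%:R.
Proof.
by move=> x0; rewrite -horner_coef0 (horner_powpoly 0)// expr0 mxE.
Qed.

(** The logarithm turns products into sums: [powpoly] is multiplicative because it
    is so at all natural numbers, and its constant coefficient is the identity, so
    the coefficients of degree 1 add up. *)
Lemma mxlog1pM x y : nilpotent_mx x -> nilpotent_mx y ->
  nilpotent_mx (x + y + x * y) -> GRing.comm x y ->
  mxlog1p (x + y + x * y) = mxlog1p x + mxlog1p y.
Proof.
move=> x0 y0 z0 xy.
have Q : powpoly (x + y + x * y) = powpoly x *m powpoly y.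
  apply/matrixP => a b; apply: poly_nat_inj => m.
  rewrite horner_powpoly// mxE horner_sum.
  under eq_bigr do rewrite hornerM !horner_powpoly//.
  have -> : 1 + (x + y + x * y) = (1 + x) * (1 + y).
    by rewrite mulrDl mul1r mulrDr mulr1 !addrA; congr (_ + _); exact: addrAC.
  rewrite exprMn_comm.
    by rewrite [LHS]mxE.
  by apply: commrD; [exact: commr1|apply: commr_sym; apply: commrD => //; exact: commr1].
apply/matrixP => a b; rewrite mxlog1pE Q [RHS]mxE !mxlog1pE mxE coef_sum.
under eq_bigr do rewrite coefM big_ord_recl big_ord1/= !powpoly0//.
rewrite big_split/=; rewrite addrC; congr (_ + _).
- rewrite (bigD1 b)//= eqxx mulr1 big1 ?addr0// => i /negPf->; exact: mulr0.
- rewrite (bigD1 a)//= eqxx mul1r big1 ?addr0// => i.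
  by rewrite eq_sym => /negPf->; exact: mul0r.
Qed.

Lemma mxlog1p0 : mxlog1p 0 = 0.
Proof.
have z0 : nilpotent_mx (0 : 'M[K]_N.+1) by rewrite /nilpotent_mx expr0n.
have := mxlog1pM z0 z0; rewrite mulr0 !addr0 => /(_ z0 (commr0 _)) /eqP.
by rewrite -subr_eq0 opprD addNKr oppr_eq0 => /eqP.
Qed.
End unipotent_log.

(** * Commutative matrix algebras with a cyclic vector *)

Lemma mulmx_col0 (K : pzSemiRingType) m n (A : 'M[K]_(m, n)) :
  (forall y : 'cV_n, A *m y = 0) -> A = 0.
Proof.
move=> A0; apply/matrixP => a b; have := A0 (delta_mx b 0).
by rewrite -colE => /matrixP/(_ a 0); rewrite !mxE.
Qed.

Section cyclic_algebra.
Variables (K : fieldType) (N : nat).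
Implicit Types (X Y e : 'M[K]_N.+1) (y w : 'cV[K]_N.+1).

(** A commutative subalgebra [A] of the matrices for which [w] is cyclic. The map
    X |-> X w is then a bijection from [A] onto the column vectors. *)
Record cyclic_algebra (A : set 'M[K]_N.+1) w : Prop := CyclicAlgebra {
  cyclic1 : A 1;
  cyclicD : forall X Y, A X -> A Y -> A (X + Y);
  cyclicZ : forall a X, A X -> A (a *: X);
  cyclicM : forall X Y, A X -> A Y -> A (X * Y);
  cyclicC : forall X Y, A X -> A Y -> GRing.comm X Y;
  cyclic_onto : forall y, exists X, A X /\ X *m w = y }.

Variables (A : set 'M[K]_N.+1) (w : 'cV[K]_N.+1).
Hypothesis Aw : cyclic_algebra A w.

Lemma cyclicB X Y : A X -> A Y -> A (X - Y).
Proof.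
by move=> AX AY; apply: (cyclicD Aw) => //; rewrite -scaleN1r; apply: (cyclicZ Aw).
Qed.

Lemma cyclic_scalar a : A a%:A.
Proof. exact: (cyclicZ Aw _ (cyclic1 Aw)). Qed.

Lemma cyclic_horner X p : A X -> A (horner_mx X p).
Proof.
move=> AX; elim/poly_ind: p => [|p c IH].
  by rewrite rmorph0 -(scale0r 1); exact: cyclic_scalar.
rewrite rmorphD rmorphM/= horner_mx_X horner_mx_C -scalemx1.
by apply: (cyclicD Aw); [exact: (cyclicM Aw)|exact: cyclic_scalar].
Qed.

(** An element of [A] that kills [w] kills Z w = y for every [y], by
    commutativity. *)
Lemma cyclic_eval_inj X Y : A X -> A Y -> X *m w = Y *m w -> X = Y.
Proof.
move=> AX AY XY; apply/eqP; rewrite -subr_eq0; apply/eqP/mulmx_col0 => y.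
have [Z [AZ <-]] := cyclic_onto Aw y.
have -> : (X - Y) *m (Z *m w) = Z *m ((X - Y) *m w).
  by rewrite !mulmxA; congr (_ *m w); apply: (cyclicC Aw) => //; exact: cyclicB.
by rewrite mulmxBl XY subrr mulmx0.
Qed.

Lemma cyclic_sum (I : finType) (a : I -> K) (B : I -> 'M[K]_N.+1) :
  (forall i, A (B i)) -> A (\sum_i a i *: B i).
Proof.
move=> AB; apply: (big_ind A) => [|X Y|i _].
- by rewrite -(scale0r 1); exact: cyclic_scalar.
- exact: (cyclicD Aw).
- exact: (cyclicZ Aw).
Qed.

Lemma cyclic_basis : exists B : 'I_N.+1 -> 'M[K]_N.+1, (forall k, A (B k)) /\
  forall y, A (\sum_k y k 0 *: B k) /\ (\sum_k y k 0 *: B k) *m w = y.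
Proof.
have [B HB] := choice (fun k => cyclic_onto Aw (delta_mx k 0)).
exists B; split => [k|y]; first by have [] := HB k.
split; first by apply: cyclic_sum => k; have [] := HB k.
rewrite mulmx_suml [RHS]matrix_sum_delta; apply: eq_bigr => k _.
by rewrite big_ord1 -scalemxAl (HB k).2.
Qed.
End cyclic_algebra.

(** * The character of a local block *)

Section character.
Variables (K : fieldType) (N : nat) (A : set 'M[K]_N.+1) (w : 'cV[K]_N.+1).
Hypothesis Aw : cyclic_algebra A w.
Variable e : 'M[K]_N.+1.
Hypotheses (Ae : A e) (ee : e * e = e) (e0 : e != 0).
Implicit Types (X Y : 'M[K]_N.+1).

(** [e] acts as the unit of the block eA, which is not the zero ring. *)
Lemma idempotent_not_nilpotent a : nilpotent_mx (a *: e) -> a = 0.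
Proof.
rewrite /nilpotent_mx exprZn => /eqP; rewrite scaler_eq0 expf_eq0/= => /orP[/eqP//|].
have eX k : e ^+ k.+1 = e.
  by elim: k => [|k IH]; [exact: expr1|rewrite exprS IH].
by rewrite eX (negPf e0).
Qed.

(** If every element of the block eA is a scalar plus a nilpotent, the scalar is a
    linear functional of X: a linear combination of commuting nilpotents is
    nilpotent, so it is enough to choose the scalars on a basis of [A]. As X is
    determined by X w, the functional has the form r X w; this makes its
    continuity evident. *)
Lemma local_character :
  (forall X, A X -> exists a, nilpotent_mx (e * (X - a%:A))) ->
  exists r : 'rV[K]_N.+1, forall X, A X ->
    nilpotent_mx (e * (X - ((r *m X *m w) 0 0)%:A)).
Proof.
move=> loc; have [B [AB BE]] := cyclic_basis Aw.
have /choice[a Ha] : forall k, exists a, nilpotent_mx (e * (B k - a%:A)).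
  by move=> k; exact: loc.
exists (\row_k a k) => X AX; set y := X *m w.
have [AS Sw] := BE y.
rewrite -mulmxA -/y mxE.
have -> : X = \sum_k y k 0 *: B k by apply: (cyclic_eval_inj Aw).
rewrite scaler_suml -sumrB mulr_sumr.
apply: (proj1 (_ : (fun Z => nilpotent_mx Z /\ A Z) _)).
apply: (big_ind (fun Z => nilpotent_mx Z /\ A Z)) => [|U V [nU AU] [nV AV]|k _].
- split; first by rewrite /nilpotent_mx expr0n.
  by rewrite -(scale0r 1); exact: cyclic_scalar Aw _.
- split; last exact: (cyclicD Aw).
  by apply: nilpotent_mxD => //; apply: (cyclicC Aw).
- rewrite [(\row_k0 _) _ _]mxE mulrC -scalerA -scalerBr -scalerAr; split.
    exact: nilpotent_mxZ.
  apply: (cyclicZ Aw); apply: (cyclicM Aw) => //.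
  by apply: (cyclicB Aw) => //; exact: cyclic_scalar Aw _.
Qed.

Variable chi : 'M[K]_N.+1 -> K.
Hypothesis chiP : forall X, A X -> nilpotent_mx (e * (X - (chi X)%:A)).

Lemma chi_uniq X a : A X -> nilpotent_mx (e * (X - a%:A)) -> a = chi X.
Proof.
move=> AX na; apply/eqP; rewrite -subr_eq0; apply/eqP/idempotent_not_nilpotent.
have -> : (a - chi X) *: e = e * (X - (chi X)%:A) + (-1) *: (e * (X - a%:A)).
  rewrite scaleN1r -mulrBr opprB [X - _ + _]addrC addrA subrK -scalerBl.
  by rewrite -scalerAr mulr1.
have AeX b : A (e * (X - b%:A)).
  by apply: (cyclicM Aw) => //; apply: (cyclicB Aw) => //; exact: cyclic_scalar Aw _.
apply: nilpotent_mxD; [|exact: chiP|exact: nilpotent_mxZ].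
by apply: (cyclicC Aw) => //; exact: (cyclicZ Aw).
Qed.

Lemma chi_local X Y : A X -> A Y -> e * X = e * Y -> chi X = chi Y.
Proof.
move=> AX AY eXY; apply: chi_uniq => //.
by have := chiP AX; rewrite !mulrBr eXY.
Qed.

Lemma chi_scalar a : chi a%:A = a.
Proof.
apply/esym/chi_uniq; first exact: cyclic_scalar Aw _.
by rewrite subrr mulr0 /nilpotent_mx expr0n.
Qed.

Lemma chiZ (a : K) X : A X -> chi (a *: X) = a * chi X.
Proof.
move=> AX; apply/esym/chi_uniq; first exact: (cyclicZ Aw).
by rewrite -scalerA -scalerBr -scalerAr; apply: nilpotent_mxZ; exact: chiP.
Qed.

Lemma chiM X Y : A X -> A Y -> chi (X * Y) = chi X * chi Y.
Proof.
move=> AX AY; apply/esym/chi_uniq; first exact: (cyclicM Aw).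
have AXc : A (X - (chi X)%:A) by apply: (cyclicB Aw) => //; exact: cyclic_scalar Aw _.
have AYc : A (Y - (chi Y)%:A) by apply: (cyclicB Aw) => //; exact: cyclic_scalar Aw _.
have AeX : A (e * (X - (chi X)%:A)) by exact: (cyclicM Aw).
have AeY : A (e * (Y - (chi Y)%:A)) by exact: (cyclicM Aw).
have -> : e * (X * Y - (chi X * chi Y)%:A) =
    e * (X - (chi X)%:A) * Y + chi X *: (e * (Y - (chi Y)%:A)).
  rewrite scalerAr -mulrA -mulrDr mulrBl -scalerAl mul1r scalerBr scalerA.
  by rewrite addrA subrK.
apply: nilpotent_mxD.
- by apply: (cyclicC Aw); [exact: (cyclicM Aw)|exact: (cyclicZ Aw)].
- by apply: nilpotent_mxM; [exact: (cyclicC Aw)|exact: chiP].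
- by apply: nilpotent_mxZ; exact: chiP.
Qed.

Lemma chi_unit X : A X -> X \is a GRing.unit -> chi X != 0.
Proof.
move=> AX uX; apply/eqP => c0.
have := chiP AX; rewrite c0 scale0r subr0 /nilpotent_mx.
rewrite exprMn_comm; last exact: (cyclicC Aw).
move/(congr1 (fun Z => Z * X ^- N.+1)); rewrite mul0r mulrK ?unitrX// => eN.
have /eqP : (1 : K) = 0 by apply: idempotent_not_nilpotent; rewrite scale1r.
by rewrite oner_eq0.
Qed.

(** On the block cut out by [e], X is [chi X] times the unipotent
    1 + [chi_nil X]. *)
Definition chi_nil X := e * ((chi X)^-1 *: X - 1).

Lemma chi_nilA X : A X -> A (chi_nil X).
Proof.
move=> AX; apply: (cyclicM Aw) => //; apply: (cyclicB Aw); last exact: (cyclic1 Aw).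
exact: (cyclicZ Aw).
Qed.

Lemma chi_nilP X : A X -> chi X != 0 -> nilpotent_mx (chi_nil X).
Proof.
move=> AX c0; rewrite /chi_nil.
have -> : (chi X)^-1 *: X - 1 = (chi X)^-1 *: (X - (chi X)%:A).
  by rewrite scalerBr scalerA mulVf// scale1r.
by rewrite -scalerAr; apply: nilpotent_mxZ; exact: chiP.
Qed.

Lemma chi_nilM X Y : A X -> A Y ->
  chi_nil (X * Y) = chi_nil X + chi_nil Y + chi_nil X * chi_nil Y.
Proof.
move=> AX AY; rewrite /chi_nil chiM// invfM.
set a := (chi X)^-1; set b := (chi Y)^-1.
have -> : e * (a *: X - 1) * (e * (b *: Y - 1)) = e * ((a *: X - 1) * (b *: Y - 1)).
  rewrite mulrA -[e * _ * e]mulrA (_ : (a *: X - 1) * e = e * (a *: X - 1)).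
    by rewrite !mulrA ee.
  apply: (cyclicC Aw) => //; apply: (cyclicB Aw); last exact: (cyclic1 Aw).
  exact: (cyclicZ Aw).
rewrite -!mulrDr; congr (e * _).
rewrite mulrBl mul1r mulrBr mulr1 -scalerAl -scalerAr scalerA.
by rewrite addrACA subrr addr0 [RHS]addrC addrA subrK.
Qed.

Lemma chi_nilZ (a : K) X : A X -> a != 0 -> chi_nil (a *: X) = chi_nil X.
Proof.
move=> AX a0; rewrite /chi_nil chiZ// scalerA; congr (e * (_ *: _ - _)).
by rewrite invfM mulrAC mulVf// mul1r.
Qed.

Lemma chi_nil_local X Y : A X -> A Y -> e * X = e * Y -> chi_nil X = chi_nil Y.
Proof.
move=> AX AY eXY; rewrite /chi_nil (chi_local AX AY eXY).
by rewrite !mulrBr -!scalerAr eXY.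
Qed.
End character.

(** * Real-valued logarithms on a local block *)

Lemma half_not_int (R : realType) (z : int) : (2^-1 : R) != z%:~R.
Proof.
apply/eqP => h; have : (1 : R) = (z * 2)%:~R by rewrite intrM -h mulVf ?pnatr_eq0.
move=> /eqP; rewrite -[1]/(1%:~R) eqr_int => /eqP; lia.
Qed.

(** Otherwise 1/2 would be a multiple of [a]. *)
Lemma int_multiples_eq0 (R : realType) (a : R) :
  (forall u : R, exists z : int, a * u = z%:~R) -> a = 0.
Proof.
move=> h; apply/eqP/negPn/negP => a0; have [z] := h (a^-1 * 2^-1).
by rewrite mulrA divff// mul1r => /eqP; rewrite (negPf (half_not_int _ _)).
Qed.

(** By the intermediate value theorem a polynomial function that takes two
    different integer values also takes a value in Z + 1/2. *)
Lemma int_valued_poly (R : realType) (p : {poly R}) :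
  (forall t, exists z : int, p.[t] = z%:~R) -> p = (p.[0])%:P.
Proof.
have nondecr (q : {poly R}) (t : R) : (forall t, exists z : int, q.[t] = z%:~R) ->
    0 <= t -> q.[0] <= q.[t] -> q.[t] = q.[0].
  move=> h t0; have [z0 E0] := h 0; have [z1 E1] := h t.
  rewrite E0 E1 ler_int le_eqVlt => /orP[/eqP->//|lt01].
  have [|x _] := @poly_ivt _ (q - (z0%:~R + 2^-1)%:P) _ _ t0.
    rewrite !hornerE E0 E1 opprD addrA subrr sub0r oppr_le0 invr_ge0 ler0n/=.
    have : (z0 + 1)%:~R <= z1%:~R :> R by rewrite ler_int; lia.
    rewrite intrD; lra.
  have [z Ez] := h x.
  rewrite rootE !hornerE Ez => /eqP h2.
  have /eqP[] := half_not_int R (z - z0); rewrite intrB; lra.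
move=> h; apply: poly_nat_inj => m; rewrite hornerC.
have [le0m|lem0] := leP p.[0] p.[m%:R]; first by apply: nondecr.
apply: oppr_inj; rewrite -!hornerN; apply: nondecr => //.
  by move=> t; have [z Ez] := h t; exists (- z); rewrite hornerN Ez intrN.
by rewrite !hornerN lerN2 ltW.
Qed.

Section log_family.
Variables (R : realType) (N : nat).
Local Notation C := R[i].

(** A family of homomorphisms from the units of [A] to the reals that see only the
    block eA, that are multiples of ln |c| on scalars, and none of whose nonzero
    real combinations is integer valued. The last condition is the form of
    independence that passes to products of blocks. Continuity is stated along an
    arbitrary parametrization of [A], since [A] is a mere set of matrices. *)
Record log_family (A : set 'M[C]_N.+1) (e : 'M[C]_N.+1) (I : finType)
    (Phi : I -> 'M[C]_N.+1 -> R) (s : I -> R) : Prop := LogFamily {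
  logM : forall i X Y, A X -> A Y -> X \is a GRing.unit -> Y \is a GRing.unit ->
    Phi i (X * Y) = Phi i X + Phi i Y;
  logZ : forall i c X, c != 0 -> A X -> X \is a GRing.unit ->
    Phi i (c *: X) = s i * ln (normc c) + Phi i X;
  log_local : forall i X Y, A X -> A Y -> e * X = e * Y -> Phi i X = Phi i Y;
  log_continuous : forall i (S : topologicalType) (s0 : S) (P : S -> 'M[C]_N.+1),
    (forall s, A (P s)) -> mxcontinuous s0 P -> P s0 \is a GRing.unit ->
    {for s0, continuous (fun s => Phi i (P s))};
  log_free : forall c : I -> R,
    (forall X, A X -> X \is a GRing.unit ->
      exists z : int, \sum_i c i * Phi i X = z%:~R) -> forall i, c i = 0 }.
End log_family.

Section block_logarithms.
Variables (R : realType) (N : nat).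
Local Notation C := R[i].
Variables (A : set 'M[C]_N.+1) (w : 'cV[C]_N.+1).
Hypothesis Aw : cyclic_algebra A w.
Variable e : 'M[C]_N.+1.
Hypotheses (Ae : A e) (ee : e * e = e) (e0 : e != 0).
Implicit Types (X Y : 'M[C]_N.+1).
Variable r : 'rV[C]_N.+1.
Local Notation chi := (fun X => (r *m X *m w) 0 0).
Hypothesis chiP : forall X, A X -> nilpotent_mx (e * (X - (chi X)%:A)).

(** The functionals applied to the logarithm: a basis of the rows [r] with r e = r
    and r w = 0. Such a functional is determined by its values on the vectors x w
    with x nilpotent in eA: for X in [A] and x = e (X - chi X) one has
    r (x w) = r (X w), and the X w fill the whole space. *)
Definition nilrows := row_base (e :&: kermx w)%MS.
Local Notation m := (\rank (e :&: kermx w)%MS).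

Lemma nilrows_e : nilrows *m e = nilrows.
Proof.
have /submxP[D ->] : (nilrows <= e)%MS.
  by rewrite eq_row_base capmxSl.
by rewrite -mulmxA; congr (_ *m _); exact: ee.
Qed.

Lemma nilrows_w : nilrows *m w = 0.
Proof. by apply/sub_kermxP; rewrite eq_row_base capmxSr. Qed.

(** Among the rows [r] with r e = r, the condition r w = 0 costs at most one
    dimension; ln |chi| makes up for it. *)
Lemma rank_nilrows : (\rank e <= m.+1)%N.
Proof.
have := mxrank_sum_cap e (kermx w); have := rank_leq_row (e + kermx w)%MS.
have := rank_leq_col w; rewrite mxrank_ker; lia.
Qed.

(** [inl] gives the logarithm of the modulus of the character, [inr] those of the
    unipotent part. *)
Definition block_log (i : ('I_1 + 'I_m)%type) X : R :=
  if i is inr j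
  then complex.Re ((nilrows *m mxlog1p (chi_nil e chi X) *m w) j 0)
  else ln (normc (chi X)).

Definition block_scale (i : ('I_1 + 'I_m)%type) : R := if i is inr _ then 0 else 1.

Lemma block_logM i X Y : A X -> A Y -> X \is a GRing.unit -> Y \is a GRing.unit ->
  block_log i (X * Y) = block_log i X + block_log i Y.
Proof.
move=> AX AY uX uY.
have cX := chi_unit Aw Ae ee e0 chiP AX uX.
have cY := chi_unit Aw Ae ee e0 chiP AY uY.
have cM := chiM Aw Ae ee e0 chiP AX AY.
case: i => [j|j] /=; first by rewrite cM ln_normcM.
have nM := chi_nilM Aw Ae ee e0 chiP AX AY.
rewrite nM mxlog1pM.
- by rewrite mulmxDr mulmxDl mxE ReD.
- exact: (chi_nilP chiP AX cX).
- exact: (chi_nilP chiP AY cY).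
- rewrite -nM; apply: (chi_nilP chiP (cyclicM Aw AX AY)).
  by rewrite cM mulf_neq0.
- by apply: (cyclicC Aw); apply: (chi_nilA Aw).
Qed.

Lemma block_logZ i c X : c != 0 -> A X -> X \is a GRing.unit ->
  block_log i (c *: X) = block_scale i * ln (normc c) + block_log i X.
Proof.
move=> c0 AX uX; have cX := chi_unit Aw Ae ee e0 chiP AX uX.
case: i => [j|j] /=.
  by rewrite mul1r (chiZ Aw Ae ee e0 chiP)// ln_normcM.
by rewrite mul0r add0r (chi_nilZ Aw Ae ee e0 chiP).
Qed.

Lemma block_log_local i X Y : A X -> A Y -> e * X = e * Y -> block_log i X = block_log i Y.
Proof.
move=> AX AY eXY; case: i => [j|j] /=.
  by rewrite (chi_local Aw Ae ee e0 chiP AX AY eXY).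
by rewrite (chi_nil_local Aw Ae ee e0 chiP AX AY eXY).
Qed.

Lemma block_log_continuous i (S : topologicalType) (s0 : S) (P : S -> 'M[C]_N.+1) :
  (forall s, A (P s)) -> mxcontinuous s0 P -> P s0 \is a GRing.unit ->
  {for s0, continuous (fun s => block_log i (P s))}.
Proof.
move=> AP cP uP; have c0 := chi_unit Aw Ae ee e0 chiP (AP s0) uP.
have cchi : ccontinuous s0 (fun s => chi (P s)).
  apply: (mxcontinuousM (mxcontinuousM (mxcontinuous_cst _ r) cP) (mxcontinuous_cst _ w)).
case: i => [j|j] /=; first exact: continuous_ln_normc.
suff H : mxcontinuous s0 (fun s => nilrows *m mxlog1p (chi_nil e chi (P s)) *m w).
  by have [] := H j 0.
apply: mxcontinuousM; last exact: mxcontinuous_cst.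
apply: mxcontinuousM; first exact: mxcontinuous_cst.
apply: mxcontinuous_sum => k.
apply: mxcontinuousZ; first exact: ccontinuous_cst.
apply: mxcontinuousX.
apply: mxcontinuousM; first exact: mxcontinuous_cst.
apply: mxcontinuousD; last exact: mxcontinuous_cst.
by apply: mxcontinuousZ => //; exact: ccontinuousV.
Qed.

(** A scalar t > 0 has trivial unipotent part, so the coefficient of ln |chi|
    times ln t is an integer for all t > 0, and this coefficient is zero. For a
    nilpotent x of the block the remaining combination, at 1 + t x, is an integer
    valued polynomial in the real variable t; its coefficient of degree 1, which is
    Re (rho x w), is therefore zero. Replacing x by i x gives rho x w = 0, whence
    rho = 0 by the choice of [nilrows]. *)
Lemma block_log_free (c : ('I_1 + 'I_m)%type -> R) :
  (forall X, A X -> X \is a GRing.unit ->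
    exists z : int, \sum_i c i * block_log i X = z%:~R) -> forall i, c i = 0.
Proof.
move=> h.
have chi1 : chi_nil e chi 1 = 0.
  have : chi 1 = 1 by have := chi_scalar Aw Ae ee e0 chiP 1; rewrite scale1r.
  by rewrite /chi_nil => ->; rewrite invr1 scale1r subrr mulr0.
have cN : c (inl 0) = 0.
  apply: int_multiples_eq0 => u.
  have u0 : ((expR u)%:C)%C != 0 :> C.
    by rewrite eq_complex /= eqxx andbT gt_eqF// expR_gt0.
  have [|] := h ((expR u)%:C)%C%:A (cyclic_scalar Aw _).
    by rewrite scalemx1 unitmxE det_scalar unitfE expf_neq0.
  move=> z Ez; exists z; rewrite -Ez big_sumType/= big_ord1/= (chi_scalar Aw Ae ee e0 chiP).
  have -> : normc ((expR u)%:C)%C = expR u.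
    by rewrite /= expr0n/= addr0 sqrtr_sqr ger0_norm// expR_ge0.
  rewrite expRK big1 ?addr0// => j _.
  rewrite (chi_nilZ Aw Ae ee e0 chiP (cyclic1 Aw) u0) chi1 mxlog1p0.
  by rewrite mulmx0 mul0mx mxE mulr0.
pose rho := \sum_j (c (inr j))%:C%C *: row j nilrows.
have rho_e : rho *m e = rho.
  rewrite mulmx_suml; apply: eq_bigr => j _.
  by rewrite -scalemxAl -row_mul nilrows_e.
have rho_w : rho *m w = 0.
  rewrite mulmx_suml big1// => j _.
  by rewrite -scalemxAl -row_mul nilrows_w row0 scaler0.
have rho_nil x : A x -> e * x = x -> nilpotent_mx x -> complex.Re ((rho *m x *m w) 0 0) = 0.
  move=> Ax ex nx.
  pose p := \poly_(k < N.+1) complex.Re ((binpoly C k)`_1 * (rho *m x ^+ k *m w) 0 0).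
  have pE (t : R) : p.[t] = \sum_i c i * block_log i (1 + (t%:C)%C *: x).
    set u := (t%:C)%C *: x.
    have Au : A (1 + u) by apply: (cyclicD Aw (cyclic1 Aw)); exact: (cyclicZ Aw).
    have eu : e * u = u by rewrite -scalerAr ex.
    have nu : nilpotent_mx u by exact: nilpotent_mxZ.
    have chiu : chi (1 + u) = 1.
      apply/esym; apply: (chi_uniq Aw Ae ee e0 chiP Au).
      by rewrite scale1r addrC addKr eu.
    have nil_u : chi_nil e chi (1 + u) = u.
      by rewrite /chi_nil chiu invr1 scale1r addrC addKr.
    rewrite big_sumType/= big_ord1 cN mul0r add0r nil_u horner_poly.
    under [RHS]eq_bigr => j _ do rewrite -ReZ.
    rewrite -Re_sum.
    have -> : \sum_j (c (inr j))%:C%C * (nilrows *m mxlog1p u *m w) j 0 =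
        (rho *m mxlog1p u *m w) 0 0.
      rewrite !mulmx_suml summxE; apply: eq_bigr => j _.
      by rewrite -!scalemxAl [RHS]mxE -!row_mul [in RHS]mxE.
    rewrite mulmx_sumr mulmx_suml summxE Re_sum; apply: eq_bigr => k _.
    have scE (a : C) (M : 'M[C]_1) : (a *: M) 0 0 = a * M 0 0 by rewrite mxE.
    rewrite /u exprZn -!scalemxAr -!scalemxAl !scE mulrCA.
    by rewrite -rmorphXn ReZ mulrC.
  have pc : p = (p.[0])%:P.
    apply: int_valued_poly => t; rewrite pE; apply: h.
      by apply: (cyclicD Aw); [exact: (cyclic1 Aw)|exact: (cyclicZ Aw)].
    by apply: nilpotent_mx_unit; exact: nilpotent_mxZ.
  have := congr1 (fun q : {poly R} => q`_1) pc.
  rewrite coefC coef_poly binpoly1 coefX mul1r expr1 /=.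
  case: ifP => // N0 _; move: nx; rewrite /nilpotent_mx.
  (* for matrices of size 1, x = 0 *)
  have {N0}N1 : N.+1 = 1%N by lia.
  by rewrite [X in x ^+ X]N1 expr1 => ->; rewrite mulmx0 mul0mx mxE.
have rho0 : rho = 0.
  apply: mulmx_col0 => y; have [X [AX <-]] := cyclic_onto Aw y.
  pose x := e * (X - (chi X)%:A).
  have Ax : A x.
    apply: (cyclicM Aw) => //; apply: (cyclicB Aw) => //; exact: cyclic_scalar Aw _.
  have ex : e * x = x by rewrite /x mulrA ee.
  have nx : nilpotent_mx x by exact: chiP.
  have -> : rho *m (X *m w) = rho *m x *m w.
    rewrite [rho *m x]mulmxA rho_e mulmxBr mulmxBl mulmxA.
    by rewrite -scalemxAr -scalemxAl mulmx1 rho_w scaler0 subr0.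
  have Re0 := rho_nil x Ax ex nx.
  have Im0 := rho_nil ('i%C *: x) (cyclicZ Aw _ Ax) _ (nilpotent_mxZ _ nx).
  rewrite -scalerAr ex in Im0; have {Im0} := Im0 erefl.
  rewrite -scalemxAr -scalemxAl mxE mulrC ReiNIm => /eqP; rewrite oppr_eq0 => /eqP Im0.
  apply/matrixP => a b; rewrite !ord1 [RHS]mxE.
  by apply/eqP; rewrite eq_complex /= Re0 Im0 !eqxx.
case=> [i|j]; first by rewrite (ord1 i).
have : \row_j (c (inr j))%:C%C *m nilrows = 0.
  by rewrite mulmx_sum_row -[RHS]rho0; apply: eq_bigr => i _; rewrite mxE.
move/eqP; rewrite mulmx_free_eq0 ?row_base_free// => /eqP/rowP/(_ j).
by rewrite !mxE => -[].
Qed.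

Lemma block_log_family : log_family A e block_log block_scale /\
  (\rank e <= #|{: ('I_1 + 'I_m)%type}|)%N.
Proof.
split; last by rewrite card_sum !card_ord rank_nilrows.
split; [exact: block_logM|exact: block_logZ|exact: block_log_local|
  exact: block_log_continuous|exact: block_log_free].
Qed.
End block_logarithms.

(** * Logarithms on the whole algebra *)

Lemma idempotent_partM (T : pzRingType) (e x y : T) : e * e = e -> x * e = e * x ->
  (e * x + (1 - e)) * (e * y + (1 - e)) = e * (x * y) + (1 - e).
Proof.
move=> ee xe.
have n1 : (1 - e) * e = 0 by rewrite mulrBl mul1r ee subrr.
have n3 : (1 - e) * (1 - e) = 1 - e by rewrite [LHS]mulrBr mulr1 n1 subr0.
have n2 : e * x * (1 - e) = 0 by rewrite mulrBr mulr1 -mulrA xe mulrA ee subrr.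
rewrite mulrDl (mulrDr (e * x)) (mulrDr (1 - e)) n2 n3 addr0.
rewrite (mulrA (1 - e)) n1 mul0r add0r; congr (_ + _).
by rewrite -mulrA [x * _]mulrA xe !mulrA ee.
Qed.

Section log_family_sum.
Variables (R : realType) (N : nat).
Local Notation C := R[i].
Variables (A : set 'M[C]_N.+1) (w : 'cV[C]_N.+1).
Hypothesis Aw : cyclic_algebra A w.
Implicit Types (X Y e : 'M[C]_N.+1).

Lemma log_family1 e (I : finType) Phi s (i : I) : log_family A e Phi s -> Phi i 1 = 0.
Proof.
move=> L; have A1 := cyclic1 Aw.
have := logM L i A1 A1 (unitr1 _) (unitr1 _).
by rewrite mulr1 => /eqP; rewrite -subr_eq0 opprD addNKr oppr_eq0 => /eqP.
Qed.

(** The unit e1 X + (1 - e1) agrees with X on the first block and with 1 on the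
    second, where the logarithms vanish. *)
Lemma log_family_part e1 e2 (I1 I2 : finType) Phi1 s1 Phi2 s2 (c1 : I1 -> R) (c2 : I2 -> R) :
  A e1 -> e1 * e1 = e1 -> e2 * e1 = 0 ->
  log_family A e1 Phi1 s1 -> log_family A e2 Phi2 s2 ->
  (forall X, A X -> X \is a GRing.unit -> exists z : int,
    \sum_i c1 i * Phi1 i X + \sum_i c2 i * Phi2 i X = z%:~R) ->
  forall i, c1 i = 0.
Proof.
move=> Ae1 e11 e21 L1 L2 h; apply: (log_free L1) => X AX uX.
pose X1 := e1 * X + (1 - e1).
have AX1 : A X1.
  by apply: (cyclicD Aw); [exact: (cyclicM Aw)|exact: (cyclicB Aw (cyclic1 Aw))].
have Xe : X * e1 = e1 * X by exact: (cyclicC Aw).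
have Ve : X^-1 * e1 = e1 * X^-1 by apply: commr_sym; apply: commrV; exact: commr_sym.
have uX1 : X1 \is a GRing.unit.
  apply/unitrP; exists (e1 * X^-1 + (1 - e1)).
  by rewrite !idempotent_partM// mulVr// mulrV// mulr1 addrC subrK.
have [z Ez] := h X1 AX1 uX1; exists z; rewrite -Ez.
rewrite [X in _ + X]big1 ?addr0 => [|i _].
  apply: eq_bigr => i _; congr (_ * _); apply: (log_local L1) => //.
  by rewrite mulrDr mulrA e11 mulrBr mulr1 e11 subrr addr0.
rewrite (log_local L2 i AX1 (cyclic1 Aw)) ?(log_family1 i L2) ?mulr0//.
by rewrite mulrDr mulrA e21 mul0r add0r mulrBr e21 subr0.
Qed.

Definition sum_fun (I1 I2 T : Type) (f : I1 -> T) (g : I2 -> T) (i : I1 + I2) :=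
  match i with inl j => f j | inr j => g j end.

Lemma log_familyD e1 e2 (I1 I2 : finType) Phi1 s1 Phi2 s2 :
  A e1 -> A e2 -> e1 * e1 = e1 -> e2 * e2 = e2 -> e1 * e2 = 0 ->
  @log_family R N A e1 I1 Phi1 s1 -> @log_family R N A e2 I2 Phi2 s2 ->
  log_family A (e1 + e2) (sum_fun Phi1 Phi2) (sum_fun s1 s2).
Proof.
move=> Ae1 Ae2 e11 e22 e12 L1 L2.
have e21 : e2 * e1 = 0 by rewrite -e12; exact: (cyclicC Aw).
split.
- by case=> i; [exact: (logM L1)|exact: (logM L2)].
- by case=> i; [exact: (logZ L1)|exact: (logZ L2)].
- case=> i X Y AX AY eXY.
  + apply: (log_local L1) => //; move/(congr1 ( *%R e1)): eXY.
    by rewrite !mulrA mulrDr e11 e12 addr0.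
  + apply: (log_local L2) => //; move/(congr1 ( *%R e2)): eXY.
    by rewrite !mulrA mulrDr e22 e21 add0r.
- by case=> i; [exact: (log_continuous L1)|exact: (log_continuous L2)].
- move=> c h; case=> i.
  + apply: (@log_family_part e1 e2 _ _ Phi1 s1 Phi2 s2 (c \o inl) (c \o inr)) => //.
    by move=> X AX uX; have [z] := h X AX uX; rewrite big_sumType; exists z.
  + apply: (@log_family_part e2 e1 _ _ Phi2 s2 Phi1 s1 (c \o inr) (c \o inl)) => //.
    by move=> X AX uX; have [z] := h X AX uX; rewrite big_sumType addrC; exists z.
Qed.
End log_family_sum.

Section splitting.
Variables (K : closedFieldType) (N : nat).
Variables (A : set 'M[K]_N.+1) (w : 'cV[K]_N.+1).
Hypothesis Aw : cyclic_algebra A w.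
Implicit Types (X Y e : 'M[K]_N.+1).

Lemma horner_mx_eigen X (U : 'M[K]_N.+1) a p :
  X * U = a *: U -> horner_mx X p * U = p.[a] *: U.
Proof.
move=> XU; elim/poly_ind: p => [|p c IH]; first by rewrite rmorph0 mul0r horner0 scale0r.
rewrite rmorphD rmorphM/= horner_mx_X horner_mx_C mulrDl -mulrA XU -scalerAr IH.
by rewrite !hornerE scalerDl scalerA mulrC -scalemx1 -scalerAl mul1r.
Qed.

(** Choose an eigenvalue a of X with an eigenvector in the image of [e] and write
    the characteristic polynomial as (X - a)^k q with q(a) nonzero. A Bezout
    relation between the two factors gives two orthogonal idempotents that are
    polynomials in X. The first one fixes the eigenvector; if the second one were
    zero on the block, X - a would be nilpotent there. *)
Lemma idempotent_split X e : A X -> A e -> e * e = e -> e != 0 ->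
  (forall a, ~ nilpotent_mx (e * (X - a%:A))) ->
  exists e1 e2, [/\ A e1, A e2, e1 != 0, e2 != 0 & e1 + e2 = e] /\
    [/\ e1 * e1 = e1, e2 * e2 = e2 & e1 * e2 = 0].
Proof.
move=> AX Ae ee e0 nl.
(* U is e Q(X) for a partial product Q of the factors of the characteristic
   polynomial such that e Q(X) is not zero and (X - a) e Q(X) is. *)
have [a [U [U0 eU XU]]] : exists a (U : 'M[K]_N.+1),
    [/\ U != 0, e * U = U & X * U = a *: U].
  have [s Es] := closed_field_poly_normal (char_poly X).
  have : e * horner_mx X (\prod_(z <- s) ('X - z%:P)) = 0.
    have := Cayley_Hamilton X; rewrite Es (monicP (char_poly_monic X)) scale1r => ->.
    exact: mulr0.
  elim: s {Es} => [|z s IH]; first by rewrite big_nil rmorph1 mulr1 => /eqP; rewrite (negPf e0).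
  rewrite big_cons rmorphM rmorphB/= horner_mx_X horner_mx_C.
  set Q := horner_mx X _ => EQ.
  have [/IH//|Q0] := eqVneq (e * Q) 0.
  exists z, (e * Q); split => //; first by rewrite mulrA ee.
  apply/eqP; rewrite -subr_eq0; apply/eqP; rewrite -[RHS]EQ.
  rewrite -scalemx1 mulrBl mulrBr mulrA (cyclicC Aw AX Ae) mulrA; congr (_ - _).
  by rewrite -scalerAl mul1r scalerAr.
have char0 : char_poly X != 0 by rewrite monic_neq0// char_poly_monic.
have [k [q]] := multiplicity_XsubC (char_poly X) a.
rewrite char0/= => qa Eq.
have : coprimep (('X - a%:P) ^+ k) q.
  by apply: coprimep_expl; rewrite coprimep_sym coprimep_XsubC.
case/Bezout_eq1_coprimepP => -[u v]/= Euv.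
have chara : (char_poly X).[a] = 0.
  have := horner_mx_eigen (char_poly X) XU; rewrite Cayley_Hamilton mul0r => /esym/eqP.
  by rewrite scaler_eq0 (negPf U0) orbF => /eqP.
have k0 : (0 < k)%N.
  case: k Eq {Euv} => // /eqP; rewrite expr0 mulr1 => /eqP Eq.
  by move: qa; rewrite -Eq rootE chara eqxx.
pose P1 := horner_mx X (v * q); pose P2 := horner_mx X (u * ('X - a%:P) ^+ k).
have AP1 : A P1 by exact: (cyclic_horner Aw).
have AP2 : A P2 by exact: (cyclic_horner Aw).
have P12 : P1 + P2 = 1 by rewrite -rmorphD addrC Euv rmorph1.
have P1P2 : P1 * P2 = 0.
  rewrite -rmorphM (_ : v * q * _ = u * v * (q * ('X - a%:P) ^+ k)); last by ring.
  by rewrite -Eq rmorphM/= Cayley_Hamilton mulr0.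
have Pe P : A P -> P * e = e * P by move=> AP; exact: (cyclicC Aw).
have P2P1 : P2 * P1 = 0 by rewrite -P1P2; exact: (cyclicC Aw).
have P11 : P1 * P1 = P1 by rewrite -[RHS]mulr1 -P12 mulrDr P1P2 addr0.
have P22 : P2 * P2 = P2 by rewrite -[RHS]mulr1 -P12 mulrDr P2P1 add0r.
have eeP P Q : A P -> (e * P) * (e * Q) = e * (P * Q).
  by move=> AP; rewrite mulrA -(mulrA e P e) (Pe _ AP) !mulrA ee.
exists (e * P1), (e * P2); split; split.
- exact: (cyclicM Aw).
- exact: (cyclicM Aw).
- apply: contraNneq U0 => eP1.
  have P2U : P2 * U = 0.
    rewrite (horner_mx_eigen _ XU) !hornerE subrr expr0n gtn_eqF// mulr0.
    exact: scale0r.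
  by rewrite -eU -[U]mul1r -P12 mulrDl P2U addr0 mulrA eP1 mul0r.
- apply/eqP => eP2; apply: (nl a); apply: (@nilpotent_mxP _ _ _ k).
  rewrite exprMn_comm; last first.
    by apply: (cyclicC Aw) => //; apply: (cyclicB Aw) => //; exact: cyclic_scalar Aw _.
  have eP1 : e = e * P1 by rewrite -[LHS]mulr1 -P12 mulrDr eP2 addr0.
  have Xak : (X - a%:A) ^+ k = horner_mx X (('X - a%:P) ^+ k).
    by rewrite rmorphXn rmorphB/= horner_mx_X horner_mx_C scalemx1.
  have P1X : P1 * (X - a%:A) ^+ k = 0.
    by rewrite Xak -rmorphM/= -mulrA -Eq rmorphM/= Cayley_Hamilton mulr0.
  have -> : e ^+ k = e ^+ k.-1 * (e * P1) by rewrite -eP1 -exprSr prednK.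
  by rewrite -!mulrA P1X !mulr0.
- by rewrite -mulrDr P12 mulr1.
- by rewrite eeP// P11.
- by rewrite eeP// P22.
- by rewrite eeP// P1P2 mulr0.
Qed.
End splitting.

Lemma idempotent_rank_lt (K : fieldType) n (e1 e2 : 'M[K]_n.+1) :
  e1 * e1 = e1 -> e2 * e2 = e2 -> e1 * e2 = 0 -> e2 * e1 = 0 -> e2 != 0 ->
  (\rank e1 < \rank (e1 + e2)%R)%N.
Proof.
move=> e11 e22 e12 e21 e20.
have le : (e1 <= (e1 + e2)%R)%MS.
  by apply/submxP; exists e1; rewrite [e1 *m _]mulrDr e11 e12 addr0.
rewrite ltn_neqAle (mxrankS le) andbT (mxrank_leqif_sup le).
apply: contra e20 => /submxP[D ED]; apply/eqP.
have := congr1 (fun Z => Z * e2) ED.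
by rewrite /= mulrDl e12 add0r e22 -[D *m e1 * e2]mulmxA [e1 *m e2]e12 mulmx0.
Qed.

(** Induction on the rank of [e]: a block on which every element is a scalar plus a
    nilpotent is treated by [block_log_family], and any other block splits. The rank
    of [e] is the dimension of eA, as X |-> X w maps eA onto the image of [e]. *)
Lemma exists_log_family (R : realType) N (A : set 'M[R[i]]_N.+1) w :
  cyclic_algebra A w -> forall e, A e -> e * e = e ->
  exists (I : finType) (Phi : I -> 'M[R[i]]_N.+1 -> R) (s : I -> R),
    log_family A e Phi s /\ (\rank e <= #|I|)%N.
Proof.
move=> Aw e; have [m] := ubnP (\rank e); elim: m e => // m IH e.
rewrite ltnS => rk Ae ee.
have [->|e0] := eqVneq e 0.
  exists 'I_0, (fun _ _ => 0), (fun=> 0); split; last by rewrite mxrank0.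
  by split; try (by case); move=> c _ [].
have [loc|] := pselect (forall X, A X -> exists a, nilpotent_mx (e * (X - a%:A))).
  have [r chiP] := local_character Aw Ae loc.
  by do 3!eexists; exact: (block_log_family Aw Ae ee e0 chiP).
move/existsNP => [X /not_implyP[AX /forallNP nl]].
have [e1 [e2 [[Ae1 Ae2 e10 e20 e12e] [e11 e22 e12]]]] :=
  idempotent_split Aw AX Ae ee e0 nl.
have e21 : e2 * e1 = 0 by rewrite -e12; exact: (cyclicC Aw).
have rk1 : (\rank e1 < m)%N.
  by apply: leq_trans rk; rewrite -e12e; exact: idempotent_rank_lt.
have rk2 : (\rank e2 < m)%N.
  by apply: leq_trans rk; rewrite -e12e addrC; exact: idempotent_rank_lt.
have [I1 [Phi1 [s1 [L1 r1]]]] := IH e1 rk1 Ae1 e11.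
have [I2 [Phi2 [s2 [L2 r2]]]] := IH e2 rk2 Ae2 e22.
do 3!eexists; split; first by rewrite -e12e; exact: (log_familyD Aw Ae1 Ae2 e11 e22 e12 L1 L2).
rewrite card_sum -e12e; apply: leq_trans (mxrank_add _ _) _; exact: leq_add.
Qed.

(** * Subspaces and linear systems *)

(** A linear set of row vectors, of unknown dimension, is everything as soon as no
    nonzero functional vanishes on it: linearly independent rows can be added one
    by one. *)
Lemma subspace_full (K : fieldType) n (S : set 'rV[K]_n) :
  S 0 -> (forall x y, S x -> S y -> S (x + y)) -> (forall a x, S x -> S (a *: x)) ->
  (forall r : 'cV_n, (forall y, S y -> y *m r = 0) -> r = 0) -> forall y, S y.
Proof.
move=> S0 SD SZ nondeg y.
have [B [SB rB]] : exists B : 'M[K]_(n, n), (forall i, S (row i B)) /\ row_free B.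
  suff : forall k, (k <= n)%N ->
      exists B : 'M[K]_(k, n), (forall i, S (row i B)) /\ row_free B by apply.
  elim=> [|k IH] kn.
    by exists 0; split; [case|rewrite /row_free mxrank0].
  have [B [SB rB]] := IH (ltnW kn).
  have [r r0 Br] : exists2 r : 'cV[K]_n, r != 0 & B *m r = 0.
    have : kermx B^T != 0.
      by rewrite kermx_eq0 /row_free mxrank_tr (eqP rB) ltn_eqF.
    case/rowV0Pn => v /sub_kermxP vB v0; exists v^T; first by rewrite trmx_eq0.
    by apply: trmx_inj; rewrite trmx_mul trmxK vB trmx0.
  have [z [Sz zr]] : exists z, S z /\ z *m r != 0.
    apply: contrapT => /forallNP h; move/eqP: r0; apply; apply: nondeg => z Sz.
    by apply: contrapT => /eqP zr; apply: (h z).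
  exists (col_mx z B : 'M[K]_(1 + k, n)); split.
    move=> i; case: (@split_ordP 1 k i) => j ->; last first.
      exact: (eq_ind_r S (SB j) (rowKd j z B)).
    apply: (eq_ind_r S _ (rowKu j z B)); rewrite (_ : row j z = z)//.
    by apply/rowP => l; rewrite mxE ord1.
  suff : (k < \rank (z + B)%MS)%N.
    rewrite addsmxE => rk; rewrite /row_free eqn_leq rk andbT.
    exact: (rank_leq_row (col_mx z B)).
  rewrite -{1}(eqP rB) ltn_neqAle (mxrankS (addsmxSr z B)) andbT.
  rewrite (mxrank_leqif_sup (addsmxSr z B)) addsmx_sub submx_refl andbT.
  by apply: contra zr => /submxP[D ->]; rewrite -mulmxA Br mulmx0.
have /submxP[D ->] : (y <= B)%MS by apply: submx_full; rewrite /row_full.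
rewrite mulmx_sum_row; elim/big_ind: _ => // i _; exact: SZ.
Qed.

(** The conditions form a linear system with n+1 equations and at least n+1
    unknowns. If the rows of its matrix are dependent, a relation between them
    gives b = 0; otherwise the matrix is invertible and the system with b = 1,
    which is not homogeneous because n > 0, has a solution. *)
Lemma integral_combination (K : fieldType) (I : finType) n (s : I -> K) (M : I -> 'I_n -> K) :
  (0 < n)%N -> (n < #|I|)%N ->
  exists c : I -> K, [/\ exists i, c i != 0, \sum_i c i * s i = 0 &
    exists b : bool, forall k, \sum_i c i * M i k = b%:R].
Proof.
move=> n0 nI.
pose A : 'M[K]_(#|I|, 1 + n) :=
  row_mx (\col_i s (enum_val i)) (\matrix_(i, k) M (enum_val i) k).
suff [c [c0 [b cA]]] : exists c : 'rV[K]_(#|I|), c != 0 /\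
    exists b : bool, c *m A = row_mx 0 (const_mx b%:R).
  exists (fun i => c 0 (enum_rank i)).
  move: cA; rewrite mul_mx_row => /eq_row_mx[cs cM]; split.
  - have [i ci] : exists i, c 0 i != 0.
      apply: contrapT => /forallNP h; move/eqP: c0; apply; apply/rowP => i.
      by rewrite mxE; apply/eqP/negPn/negP => /(h i).
    by exists (enum_val i); rewrite enum_valK.
  - have := congr1 (fun Z : 'M[K]_1 => Z 0 0) cs; rewrite !mxE => cs0; apply: etrans cs0.
    rewrite (reindex _ (onW_bij _ (@enum_val_bij I)))/=.
    by apply: eq_bigr => i _; rewrite mxE enum_valK.
  - exists b => k; have := congr1 (fun Z : 'rV[K]_n => Z 0 k) cM.
    rewrite !mxE => cMk; apply: etrans cMk.
    rewrite (reindex _ (onW_bij _ (@enum_val_bij I)))/=.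
    by apply: eq_bigr => i _; rewrite mxE enum_valK.
have [free|/negP] := boolP (row_free A).
  have full : row_full A.
    have := rank_leq_col A; move: free; rewrite /row_free /row_full => /eqP-> h.
    by rewrite eqn_leq h.
  have /submxP[c Ec] := submx_full (row_mx 0 (const_mx 1) : 'M[K]_(1, 1 + n)) full.
  exists c; split; last by exists true.
  apply: contraTneq n0 => c0; move: Ec; rewrite c0 mul0mx => /(congr1 rsubmx).
  rewrite row_mxKr linear0; case: n {nI M A free full c c0} => // n /matrixP/(_ 0 0).
  by rewrite !mxE => /eqP; rewrite oner_eq0.
move/negP; rewrite -kermx_eq0 => /rowV0Pn[c /sub_kermxP cA c0].
exists c; split => //; exists false; rewrite cA -[LHS]row_mx0; congr row_mx.
Qed.

(** * Affine maps as matrices and dense orbits *)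

(** The integers are closed in the reals. *)
Lemma dense_int_valued (R : realType) (T : topologicalType) (D : set T) (u : T -> R) x :
  dense D -> {for x, continuous u} -> (forall y, D y -> exists z : int, u y = z%:~R) ->
  exists z : int, u x = z%:~R.
Proof.
move=> dD cu Du; exists (Num.floor (u x)); apply/eqP/negPn/negP => ne.
set m := Num.floor (u x) in ne.
have mu : m%:~R < u x by rewrite lt_neqAle eq_sym ne ge_floor.
have um : u x < (m + 1)%:~R by exact: floorD1_gt.
have [y [By Dy]] : exists y, (m%:~R < u y < (m + 1)%:~R) /\ D y.
  pose B := [set y | m%:~R < u y < (m + 1)%:~R].
  have nB : nbhs x B.
    have := cu [set r | m%:~R < r < (m + 1)%:~R]; apply.
    have : u x \in `]m%:~R, (m + 1)%:~R[ by rewrite in_itv /= mu um.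
    by move=> /near_in_itvoo; apply: filterS => r; rewrite in_itv.
  have [|y [/interior_subset By Dy]] := dD (interior B) _ (open_interior B).
    by exists x.
  by exists y.
have [z uz] := Du y Dy; move: By; rewrite uz !ltr_int; lia.
Qed.

Section lift.
Variables (K : pzRingType) (n : nat).

(** Affine maps of K^n are the restrictions to this slice of linear maps of
    K^(1+n). *)
Definition lift (x : 'cV[K]_n) : 'cV[K]_(1 + n) := col_mx 1%:M x.

Definition lift_mx (A : 'M[K]_n) (a : 'cV[K]_n) : 'M[K]_(1 + n) := block_mx 1%:M 0 a A.

Lemma lift_mxE A a x : lift_mx A a *m lift x = lift (A *m x + a).
Proof. by rewrite mul_block_col !mulmx1 !mul0mx addr0 addrC. Qed.

Lemma mulmx_lift0 m (Z : 'M[K]_(m, 1 + n)) : (forall x, Z *m lift x = 0) -> Z = 0.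
Proof.
rewrite -[Z]hsubmxK => h.
have h0 : lsubmx Z = 0.
  by have := h 0; rewrite mul_row_col mulmx0 addr0 mulmx1.
rewrite h0 (_ : rsubmx Z = 0) ?row_mx0//; apply: mulmx_col0 => y.
by have := h y; rewrite h0 mul_row_col mul0mx add0r.
Qed.

Lemma mulmx_lift_inj m (Z T : 'M[K]_(m, 1 + n)) :
  (forall x, Z *m lift x = T *m lift x) -> Z = T.
Proof.
move=> h; apply/eqP; rewrite -subr_eq0; apply/eqP/mulmx_lift0 => x.
by rewrite mulmxBl h subrr.
Qed.
End lift.

Lemma unitmx_injective (K : fieldType) n (A : 'M[K]_n) :
  (forall y : 'cV_n, A *m y = 0 -> y = 0) -> A \in unitmx.
Proof.
move=> h; rewrite -unitmx_tr -row_free_unit -kermx_eq0; apply/negPn/negP.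
case/rowV0Pn => v /sub_kermxP vA /negP[]; apply/eqP/trmx_inj.
by rewrite trmx0; apply: h; apply: trmx_inj; rewrite trmx_mul trmxK vA trmx0.
Qed.

Lemma lift_mx_unit (K : fieldType) n (A : 'M[K]_n) a :
  injective (fun x => A *m x + a) -> lift_mx A a \in unitmx.
Proof.
move=> inj; apply: unitmx_injective => y.
rewrite -[y]vsubmxK mul_block_col !mul1mx !mul0mx addr0 -[RHS]col_mx0.
case/eq_col_mx => u0; rewrite u0 mulmx0 add0r => Ad.
have -> : dsubmx y = 0 by apply: inj; rewrite Ad mulmx0.
by rewrite col_mx0.
Qed.

(** The generated semigroup is the smallest among the semigroups of affine maps, so
    an invariant can be propagated only together with affinity. *)
Lemma semigroup_generated_ind (R : realType) n (S : set ('cV[R[i]]_n -> 'cV[R[i]]_n))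
    (P : 'M[R[i]]_(1 + n) -> Prop) :
  (forall f, S f -> MA f /\ exists X, P X /\ forall x, X *m lift x = lift (f x)) ->
  (forall X Y, P X -> P Y -> P (X *m Y)) ->
  forall g, semigroup_generated S g -> exists X, P X /\ forall x, X *m lift x = lift (g x).
Proof.
move=> PS PM g Sg.
suff [_] : MA g /\ exists X, P X /\ forall x, X *m lift x = lift (g x) by [].
apply: (Sg [set g | MA g /\ exists X, P X /\ forall x, X *m lift x = lift (g x)]).
split=> //; split=> [f [] //|f1 f2 [[A1 [a1 E1]] [X1 [P1 L1]]] [[A2 [a2 E2]] [X2 [P2 L2]]]].
split.
  exists (A1 *m A2), (A1 *m a2 + a1) => x.
  by rewrite /= E2 E1 mulmxDr mulmxA addrA.
by exists (X1 *m X2); split; [exact: PM|move=> x; rewrite -mulmxA L2 L1].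
Qed.

Lemma mxcontinuous_lift (R : realType) n (x : 'cV[R[i]]_n) :
  mxcontinuous x (@lift R[i] n).
Proof.
move=> k j; rewrite (ord1 j); case: (split_ordP k) => l ->.
  rewrite (_ : (fun s => _) = fun=> 1); first exact: ccontinuous_cst.
  by apply/funext => s; rewrite col_mxEu (ord1 l) mxE.
rewrite (_ : (fun s => _) = fun s : 'cV_n => s l 0); first exact: ccontinuous_coord.
by apply/funext => s; rewrite col_mxEd.
Qed.

(** An affine function that vanishes on a dense set vanishes everywhere. *)
Lemma dense_lift_nondegenerate (R : realType) n (D : set 'cV[R[i]]_n) (r : 'rV[R[i]]_(1 + n)) :
  dense D -> (forall y, D y -> r *m lift y = 0) -> r = 0.
Proof.
move=> dD rD; apply: mulmx_lift0 => x.
have [cRe cIm] : ccontinuous x (fun y => (r *m lift y) 0 0).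
  exact: (mxcontinuousM (mxcontinuous_cst _ _) (mxcontinuous_lift _)).
(* all real multiples of u are integer valued on D, hence at x *)
have Dx (u : 'cV[R[i]]_n -> R) :
    {for x, continuous u} -> (forall y, D y -> u y = 0) -> u x = 0.
  move=> cu u0; apply: int_multiples_eq0 => t.
  have [|y Dy|z Ez] := @dense_int_valued R _ D (fun y => u y * t) x dD.
  - by apply: continuousM => //; exact: cst_continuous.
  - by exists 0; rewrite u0// mul0r.
  - by exists z.
apply/matrixP => a b; rewrite !ord1 [RHS]mxE; apply/eqP; rewrite eq_complex /=.
by rewrite (Dx _ cRe) ?(Dx _ cIm) ?eqxx// => y Dy; rewrite (rD y Dy) mxE.
Qed.

(** * The algebra generated by the maps *)

Section double_commutant.
Variables (K : pzRingType) (N : nat) (I : Type) (F : I -> 'M[K]_N.+1).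

Definition commutant : set 'M[K]_N.+1 := [set X | forall k, GRing.comm X (F k)].

(** Unlike the algebra of polynomials in the matrices, the double commutant needs
    no enumeration of monomials to be seen to be a commutative algebra. *)
Definition double_commutant : set 'M[K]_N.+1 :=
  [set X | forall Y, commutant Y -> GRing.comm X Y].

Hypothesis FC : forall k l, GRing.comm (F k) (F l).

Lemma double_commutant_gen k : double_commutant (F k).
Proof. by move=> Y cY; apply: commr_sym; exact: cY. Qed.

Lemma double_commutantC X Y :
  double_commutant X -> double_commutant Y -> GRing.comm X Y.
Proof. by move=> AX AY; apply: AX => k; apply: AY => l; exact: FC. Qed.
End double_commutant.

(** The vectors X w form a subspace, which is full because no nonzero functional
    vanishes on it. *)
Lemma cyclic_double_commutant (K : fieldType) N (I : Type) (F : I -> 'M[K]_N.+1)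
    (w : 'cV[K]_N.+1) :
  (forall k l, GRing.comm (F k) (F l)) ->
  (forall r : 'rV_N.+1, (forall X, double_commutant F X -> r *m (X *m w) = 0) -> r = 0) ->
  cyclic_algebra (double_commutant F) w.
Proof.
move=> FC nondeg.
have A1 : double_commutant F 1 by move=> Y _; exact: commr_sym (commr1 Y).
have AD X Y : double_commutant F X -> double_commutant F Y -> double_commutant F (X + Y).
  move=> AX AY Z cZ; apply: commr_sym.
  by apply: commrD; apply: commr_sym; [exact: AX|exact: AY].
have AZ a X : double_commutant F X -> double_commutant F (a *: X).
  by move=> AX Z cZ; rewrite /GRing.comm -scalerAl -scalerAr AX.
split => //.
- move=> X Y AX AY Z cZ; apply: commr_sym.
  by apply: commrM; apply: commr_sym; [exact: AX|exact: AY].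
- exact: double_commutantC.
move=> y.
suff : forall z : 'rV[K]_N.+1, exists X, double_commutant F X /\ (X *m w)^T = z.
  by case/(_ y^T) => X [AX /trmx_inj]; exists X.
apply: (@subspace_full K _ [set z | exists X, double_commutant F X /\ (X *m w)^T = z]).
- by exists 0; split; [rewrite -(scale0r 1); exact: AZ|rewrite mul0mx trmx0].
- move=> _ _ [X [AX <-]] [Y [AY <-]]; exists (X + Y); split; first exact: AD.
  by rewrite mulmxDl linearD.
- move=> a _ [X [AX <-]]; exists (a *: X); split; first exact: AZ.
  by rewrite -scalemxAl linearZ.
- move=> r hr; apply: trmx_inj; rewrite trmx0; apply: nondeg => X AX.
  apply: trmx_inj; rewrite trmx_mul trmxK trmx0; apply: hr; by exists X.
Qed.

Theorem corollary1p4 (R : realType) (n : nat) (hn : (1 <= n)%N)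
    (G : set ('cV[R[i]]_n -> 'cV[R[i]]_n))
    (hG : subsemigroup_MA G) (hab : abelian_maps G)
    (f : 'I_n -> 'cV[R[i]]_n -> 'cV[R[i]]_n)
    (hf : forall k, MA (f k))
    (hinv : forall k, bijective (f k))
    (hcomm : forall k l, f k \o f l = f l \o f k)
    (hgen : G = semigroup_generated (range f)) :
  ~ exists v : 'cV[R[i]]_n, dense (orbit_of G v).
Proof.
move=> [v dv].
have /choice[F HF] : forall k, exists F : 'M[R[i]]_n.+1, F \is a GRing.unit /\
    forall x, F *m lift x = lift (f k x).
  move=> k; have [A [a E]] := hf k; exists (lift_mx A a); split.
    apply: lift_mx_unit => x y; rewrite -!E; exact: bij_inj.
  by move=> x; rewrite lift_mxE E.
have uF k : F k \is a GRing.unit by have [] := HF k.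
have Flift k x : F k *m lift x = lift (f k x) by have [] := HF k.
have FC k l : GRing.comm (F k) (F l).
  apply: mulmx_lift_inj => x; rewrite -!mulmxA !Flift.
  by have /(congr1 (fun h => h x)) /= -> := hcomm k l.
set A := double_commutant F.
pose w : 'cV[R[i]]_n.+1 := lift v.
have Gind P : (forall k, P (F k)) -> (forall X Y, P X -> P Y -> P (X * Y)) ->
    forall g, G g -> exists X, P X /\ forall x, X *m lift x = lift (g x).
  move=> PF PM g; rewrite hgen; apply: semigroup_generated_ind => //.
  by move=> _ [k _ <-]; split; [exact: hf|exists (F k)].
have AFM X Y : A X -> A Y -> A (X * Y).
  move=> AX AY Z cZ; apply: commr_sym.
  by apply: commrM; apply: commr_sym; [exact: AX|exact: AY].
have Aw : cyclic_algebra A w.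
  apply: cyclic_double_commutant => // r hr.
  apply: (dense_lift_nondegenerate dv) => _ [g Gg <-].
  have [X [AX LX]] := Gind A (double_commutant_gen (F := F)) AFM g Gg.
  by rewrite -LX; exact: hr.
have [I [Phi [s [L]]]] := exists_log_family Aw (cyclic1 Aw) (mulr1 1).
rewrite mxrank1 => nI.
have [c [[i0 ci0] cs [b cF]]] := integral_combination s (fun i k => Phi i (F k)) hn nI.
pose phi X := \sum_i c i * Phi i X.
have phiM X Y : A X -> A Y -> X \is a GRing.unit -> Y \is a GRing.unit ->
    phi (X * Y) = phi X + phi Y.
  move=> AX AY uX uY; rewrite -big_split; apply: eq_bigr => i _.
  by rewrite (logM L)// mulrDr.
have phiZ a X : a != 0 -> A X -> X \is a GRing.unit -> phi (a *: X) = phi X.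
  move=> a0 AX uX.
  rewrite /phi; under eq_bigr do rewrite (logZ L)// mulrDr mulrA.
  by rewrite big_split/= -mulr_suml cs mul0r add0r.
have Gphi := Gind (fun X => [/\ A X, X \is a GRing.unit & exists z : int, phi X = z%:~R]).
have {}Gphi g : G g -> exists X, [/\ A X, X \is a GRing.unit & exists z : int, phi X = z%:~R] /\
    forall x, X *m lift x = lift (g x).
  apply: Gphi => [k|X Y [AX uX [z Ez]] [AY uY [t Et]]].
    split => //; first exact: (double_commutant_gen (F := F)).
    by exists b; rewrite /phi cF.
  split; [exact: AFM|by rewrite unitrMl|exists (z + t)].
  by rewrite phiM// Ez Et intrD.
suff phi_int X : A X -> X \is a GRing.unit -> exists z : int, phi X = z%:~R.
  by have := log_free L phi_int i0; move/eqP; rewrite (negPf ci0).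
move=> AX uX.
(* The first coordinate row is fixed by the lifts, so it is a joint eigenvector of
   A; hence the first coordinate of X w is not zero and X w is a multiple of a
   point of the slice. *)
pose e0 : 'rV[R[i]]_(1 + n) := row_mx 1%:M 0.
have e0_lift x : e0 *m lift x = 1%:M by rewrite mul_row_col mul1mx mul0mx addr0.
have e0_eval (y : 'cV[R[i]]_(1 + n)) : e0 *m y = usubmx y.
  by rewrite -[y in LHS]vsubmxK mul_row_col mul1mx mul0mx addr0.
pose a := (e0 *m (X *m w)) 0 0.
have e0Xw : e0 *m (X *m w) = a%:M by exact: mx11_scalar.
have e0X : e0 *m X = a *: e0.
  apply/eqP; rewrite -subr_eq0; apply/eqP.
  apply: (dense_lift_nondegenerate dv) => _ [g Gg <-].
  have [Y [[AY _ _] LY]] := Gphi g Gg.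
  have e0Y : e0 *m Y = e0.
    by apply: mulmx_lift_inj => x; rewrite -mulmxA LY !e0_lift.
  have XYw : X *m (Y *m w) = Y *m (X *m w).
    by rewrite !mulmxA; congr (_ *m w); exact: (cyclicC Aw).
  rewrite mulmxBl -scalemxAl e0_lift scalemx1 -LY -(mulmxA e0) [X *m _]XYw.
  by rewrite (mulmxA e0) e0Y e0Xw subrr.
have a0 : a != 0.
  apply/eqP => a0; have : e0 *m lift v = 0.
    by rewrite -[e0](mulmxK uX) e0X a0 scale0r !mul0mx.
  by rewrite e0_lift => /matrixP/(_ 0 0) /eqP; rewrite !mxE oner_eq0.
pose z0 := a^-1 *: dsubmx (X *m w : 'cV[R[i]]_(1 + n)).
have Xw : X *m w = a *: lift z0.
  apply: etrans (esym (vsubmxK (X *m w : 'cV[R[i]]_(1 + n)))) _.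
  by rewrite -e0_eval e0Xw /lift scale_col_mx scalemx1 /z0 scalerA mulfV// scale1r.
have [B [AB BE]] := cyclic_basis Aw.
pose P (z : 'cV[R[i]]_n) : 'M[R[i]]_n.+1 := \sum_k (a *: lift z : 'cV[R[i]]_n.+1) k 0 *: B k.
have AP z : A (P z) by have [] := BE (a *: lift z).
have Pw z : P z *m w = a *: lift z by have [] := BE (a *: lift z).
have PX : P z0 = X by apply: (cyclic_eval_inj Aw) => //; rewrite Pw Xw.
have cP : mxcontinuous z0 P.
  apply: mxcontinuous_sum => k; apply: mxcontinuousZ; last exact: mxcontinuous_cst.
  exact: (mxcontinuousZ (ccontinuous_cst _ a) (mxcontinuous_lift _)).
have cphi : {for z0, continuous (fun z => phi (P z))}.
  have csum (r : seq I) : {for z0, continuous (fun z => \sum_(i <- r) c i * Phi i (P z))}.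
    elim: r => [|i r IH].
      rewrite (_ : (fun z => _) = fun=> 0); first exact: cst_continuous.
      by apply/funext => z; rewrite big_nil.
    rewrite (_ : (fun z => _) = fun z => c i * Phi i (P z) + \sum_(j <- r) c j * Phi j (P z)).
      apply: continuousD => //; apply: continuousM; first exact: cst_continuous.
      by apply: (log_continuous L) => //; rewrite PX.
    by apply/funext => z; rewrite big_cons.
  exact: csum.
rewrite -PX; apply: (dense_int_valued dv cphi) => _ [g Gg <-].
have [Y [[AY uY [z Ez]] LY]] := Gphi g Gg.
exists z; rewrite -Ez -(phiZ a Y)//; congr phi.
by apply: (cyclic_eval_inj Aw) => //; [exact: (cyclicZ Aw)|rewrite Pw -scalemxAl LY].
Qed.
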